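(* Let $p,q,r>1$. Then for any $k\in(0,1)$, $$E_{p,q,r}(k)K_{p,r,q}'(k)+K_{p,q,r}(k)E_{p,r,q}'(k)-K_{p,q,r}(k)K_{p,r,q}'(k)=\frac{\pi_{p,q}}{2r}B\left(\frac1{p^*}+\frac1q,\frac1r\right);$$ in particular the left-hand side is a non-zero constant independent of $k$. Moreover, the functions on $(0,1)$ $$y_1(k):=K_{p,q,r}(k),\qquad y_2(k):=k^{q/p-1}(k')^{1-r/p}K_{p,r,q}'(k),\qquad k':=(1-k^q)^{1/r},$$ are linearly dependent if and only if $\alpha:=\frac1q+\frac1r-\frac1p=0$, i.e. $1/q+1/r=1/p$.
   Context: For $s>1$, $s^*:=s/(s-1)$; $B$ is the beta function; $\pi_{p,q}:=2\int_0^1(1-t^q)^{-1/p}\,dt=\frac2qB\left(\frac1{p^*},\frac1q\right)$. For $p,q,r>1$ and $k\in[0,1)$, $$K_{p,q,r}(k):=\int_0^1\frac{dt}{(1-t^q)^{1/p}(1-k^qt^q)^{1-1/r}},\qquad E_{p,q,r}(k):=\int_0^1\frac{(1-k^qt^q)^{1/r}}{(1-t^q)^{1/p}}\,dt.$$ The prime does not denote a derivative: for $k\in(0,1)$, $K_{p,r,q}'(k):=K_{p,r,q}(k')$ and $E_{p,r,q}'(k):=E_{p,r,q}(k')$ with $k'=(1-k^q)^{1/r}$ (note that the second and third indices are interchanged), i.e. $K_{p,r,q}'(k)=\int_0^1\frac{dt}{(1-t^r)^{1/p}(1-(1-k^q)t^r)^{1-1/q}}$ and $E_{p,r,q}'(k)=\int_0^1\frac{(1-(1-k^q)t^r)^{1/q}}{(1-t^r)^{1/p}}\,dt$.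 *)

(* Defs.v *)
From HB Require Import structures.
From mathcomp Require Import all_boot all_order all_algebra.
From mathcomp Require Import all_classical all_reals all_analysis.
Set Implicit Arguments.
Unset Strict Implicit.
Unset Printing Implicit Defensive.
Import Order.TTheory GRing.Theory Num.Theory.
Import numFieldNormedType.Exports.
Local Open Scope classical_set_scope.
Local Open Scope ring_scope.

(* The integrals over [0, 1] below are Lebesgue integrals; the integrands are
   nonnegative, so these agree with the improper Riemann integrals.  An
   integrand may blow up at an endpoint, where the conventions 0 `^ a = 0 for
   a != 0 and 0^-1 = 0 give it an irrelevant finite value. *)

Definition dual_exponent (R : realType) (s : R) : R := s / (s - 1).

(* B(a, b) for real a, b > 0; the library's [beta_fun] takes natural numbers
   only. *)
Definition Beta (R : realType) (a b : R) : R :=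
  \int[@lebesgue_measure R]_(t in `[0, 1])
    (t `^ (a - 1) * (1 - t) `^ (b - 1)).

(* The generalized pi, pi_{p,q}. *)
Definition gen_pi (R : realType) (p q : R) : R :=
  2 * \int[@lebesgue_measure R]_(t in `[0, 1]) ((1 - t `^ q) `^ (- p^-1)).

Definition ellK (R : realType) (p q r k : R) : R :=
  \int[@lebesgue_measure R]_(t in `[0, 1])
    ((1 - t `^ q) `^ p^-1 * (1 - k `^ q * t `^ q) `^ (1 - r^-1))^-1.

Definition ellE (R : realType) (p q r k : R) : R :=
  \int[@lebesgue_measure R]_(t in `[0, 1])
    ((1 - k `^ q * t `^ q) `^ r^-1 / (1 - t `^ q) `^ p^-1).

(* The complementary modulus k'. *)
Definition comodulus (R : realType) (q r k : R) : R := (1 - k `^ q) `^ r^-1.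

(* Pitfall: the indices are in the order of the notations K'_{p,r,q} and
   E'_{p,r,q}, so that the arguments r, q are swapped with respect to
   [comodulus]; the prime is not a derivative. *)
Definition ellK' (R : realType) (p r q k : R) : R :=
  ellK p r q (comodulus q r k).

Definition ellE' (R : realType) (p r q k : R) : R :=
  ellE p r q (comodulus q r k).

Definition linearly_dependent_on (R : realType) (D : set R) (f g : R -> R) :
    Prop :=
  exists a b : R, (a, b) <> (0, 0) /\ forall x, D x -> a * f x + b * g x = 0.

(* Main.v *)
(** With x = 1/q, y = 1/r, a = 1/p, m = k^q and n = 1 - m, the substitution
    u = t^q turns K and E into Euler integrals of
    u^(x-1) (1-u)^(-a) (1-mu)^e, and K', E' into the same integrals with x and y
    exchanged and m replaced by n.  The left-hand side becomes the double
    integral over the unit square of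
      u^(x-1) v^(y-1) ((1-u)(1-v))^(-a) (1-mu)^(y-1) (1-nv)^(x-1) (1-mu-nv).
    The map X = u (1-nv), Y = v (1-mu) sends the square onto the simplex
    X, Y > 0, X + Y < 1; there 1-X-Y = (1-u)(1-v) and the Jacobian is exactly
    1-mu-nv, so the integral is the Dirichlet integral of
    X^(x-1) Y^(y-1) (1-X-Y)^(-a), which does not depend on m.

    For the linear dependence, Euler's substitution u = w/(1-m+mw) exhibits
    y_1 and y_2 as (1-m)^(y-a) times positive multiples of L(x, y, m) and
    L(y, x, 1-m), where
      L(x, y, m) = int_0^1 w^(x-1) (1-w)^(-a) (1-m+mw)^(-alpha) dw.
    If alpha = 0 both are constant; otherwise one of them strictly increases and
    the other strictly decreases with m, so they cannot be proportional. *)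

Require Import Defs.
From HB Require Import structures.
From mathcomp Require Import all_boot all_order all_algebra.
From mathcomp Require Import all_classical all_reals all_analysis measurable_realfun.
From mathcomp Require Import ring lra.
Import Order.TTheory GRing.Theory Num.Theory.
Import numFieldNormedType.Exports.
Local Open Scope classical_set_scope.
Local Open Scope ring_scope.
Set Implicit Arguments.
Unset Strict Implicit.

(** * Substitution in integrals over open intervals *)

(** Monotone convergence along compact intervals that fill []a, b[]. Since [g] is nonnegative, no
    integrability is assumed and the limit may be [+oo]. *)
Lemma cvg_integral_exhaust (R : realType) (a b : R) (u v : R ^nat) (g : R -> R) :
  {homo u : m n / (m <= n)%N >-> n <= m} ->
  {homo v : m n / (m <= n)%N >-> m <= n} ->
  (forall n, a < u n) -> (forall n, v n < b) ->
  (forall y, a < y < b -> exists n, u n <= y <= v n) ->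
  {in `]a, b[, continuous g} -> (forall x, a < x < b -> 0 <= g x) ->
  (\int[@lebesgue_measure R]_(x in `[u n, v n]) (g x)%:E)%E @[n --> \oo] -->
  (\int[@lebesgue_measure R]_(x in `]a, b[) (g x)%:E)%E.
Proof.
move=> ndu ndv au vb uv cg g0.
have sub n : [set` `[u n, v n]] `<=` [set` `]a, b[].
  move=> x /=; rewrite !in_itv/= => /andP[ux xv].
  by rewrite (lt_le_trans (au n) ux) (le_lt_trans xv (vb n)).
have -> : [set` `]a, b[] = \bigcup_n [set` `[u n, v n]].
  apply/seteqP; split => [x /=|x [n _] /sub //].
  by rewrite in_itv/= => /uv[n unv]; exists n => //=; rewrite in_itv.
have mg : measurable_fun [set` `]a, b[] g.
  by apply: open_continuous_measurable_fun => // x; rewrite inE => /cg.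
apply: ge0_nondecreasing_set_cvg_integral => //.
- move=> m n mn; apply/subsetPset => x /=; rewrite !in_itv/= => /andP[ux xv].
  by rewrite (le_trans (ndu _ _ mn) ux) (le_trans xv (ndv _ _ mn)).
- by move=> n; apply/measurable_EFinP; apply: measurable_funS (sub n) mg.
- by move=> n x /sub/=; rewrite in_itv/= lee_fin => /g0.
Qed.

Lemma itv_exhaust (R : realType) (a b : R) : a < b -> exists u v : R ^nat,
  [/\ {homo u : m n / (m <= n)%N >-> n <= m},
      {homo v : m n / (m <= n)%N >-> m <= n},
      forall n, a < u n <= v n /\ v n < b &
      forall y, a < y < b -> exists n, u n <= y <= v n].
Proof.
(* The denominator [n.+2] keeps [e n] at most half the length, so that [u n <= v n] already for n =
   0. *)
move=> ab; pose e n : R := (b - a) / n.+2%:R.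
have ba : 0 < b - a by rewrite subr_gt0.
have e0 n : 0 < e n by rewrite divr_gt0.
have e2 n : e n <= (b - a) / 2.
  by rewrite /e ler_pM2l// lef_pV2 ?posrE// ler_nat.
have ede m n : (m <= n)%N -> e n <= e m.
  by move=> mn; rewrite /e ler_pM2l// lef_pV2 ?posrE// ler_nat.
have small d : 0 < d -> exists n, forall m, (n <= m)%N -> e m <= d.
  move=> d0; exists (Num.trunc ((b - a) / d)) => m nm.
  rewrite ler_pdivrMr// -ler_pdivrMl// mulrC.
  apply: (le_trans (ltW (truncnS_gt _))).
  by rewrite ler_nat; apply: leqW.
exists (fun n => a + e n), (fun n => b - e n); split.
- by move=> m n mn; rewrite lerD2l ede.
- by move=> m n mn; rewrite lerD2l lerN2 ede.
- by move=> n; have := e0 n; have := e2 n; split; [apply/andP; split|]; lra.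
- move=> y /andP[ay yb].
  have [|n hn] := small (y - a); first by rewrite subr_gt0.
  have [|m hm] := small (b - y); first by rewrite subr_gt0.
  exists (maxn n m); have := hn _ (leq_maxl n m); have := hm _ (leq_maxr n m).
  by move=> ? ?; apply/andP; split; lra.
Qed.

(** [F], [f] and [G] are controlled only inside the open intervals, so both integrands may be
    singular at the ends. The substitution is made on compact subintervals [[u n, v n]], whose
    images exhaust []c, d[] by surjectivity of [F]. *)
Lemma ge0_integration_by_substitution_oo (R : realType) (F f G : R -> R)
    (a b c d : R) : a < b ->
  (forall t, a < t < b -> c < F t < d) ->
  (forall y, c < y < d -> exists2 t, a < t < b & F t = y) ->
  (forall t, a < t < b -> is_derive t 1 F (f t)) ->
  {in `]a, b[, continuous f} -> (forall t, a < t < b -> 0 < f t) ->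
  {in `]c, d[, continuous G} -> (forall y, c < y < d -> 0 <= G y) ->
  (\int[@lebesgue_measure R]_(y in `]c, d[) (G y)%:E)%E =
  (\int[@lebesgue_measure R]_(t in `]a, b[) (G (F t) * f t)%:E)%E.
Proof.
move=> ab FI Fsurj dF cf f0 cG G0.
have F'E t : a < t < b -> F^`()%classic t = f t.
  by move=> tab; rewrite derive1E; have [_ ->] := dF _ tab.
have cF : {in `]a, b[, continuous F}.
  move=> t; rewrite in_itv/= => tab; apply: differentiable_continuous.
  by apply/derivable1_diffP; have [] := dF _ tab.
have incF : {in `]a, b[ &, {homo F : x y / x < y}}.
  apply: gtr0_derive1_lt_oo => t; rewrite ?inE/= ?in_itv/= => tab.
  - by have [] := dF _ tab.
  - by rewrite F'E// f0.
  - by apply: cF; rewrite in_itv.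
have cF' : {in `]a, b[, continuous F^`()%classic}.
  move=> t tab; rewrite /continuous_at F'E; last by move: tab; rewrite in_itv.
  apply: cvg_trans (cf _ tab); apply: near_eq_cvg.
  near=> s; rewrite F'E//.
  have : s \in `]a, b[ by near: s; exact: near_in_itvoo.
  by rewrite in_itv.
have [u [v [ndu ndv uv exh]]] := itv_exhaust ab.
have uab n : a < u n < b by case: (uv n) => /andP[-> uvn] /(le_lt_trans uvn).
have vab n : a < v n < b.
  by case: (uv n) => /andP[au uvn] ->; rewrite (lt_le_trans au uvn).
have sub n t : t \in `[u n, v n] -> a < t < b.
  rewrite in_itv/= => /andP[ut tv].
  case/andP: (uab n) => au _; case/andP: (vab n) => _ vb.
  by rewrite (lt_le_trans au ut) (le_lt_trans tv vb).
have incFle s t : a < s < b -> a < t < b -> s <= t -> F s <= F t.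
  move=> sab tab; rewrite le_eqVlt => /predU1P[->//|st].
  by apply/ltW/incF; rewrite ?in_itv.
have cvgG : (fun n => (\int[@lebesgue_measure R]_(y in `[F (u n), F (v n)])
    (G y)%:E)%E) @ \oo --> (\int[@lebesgue_measure R]_(y in `]c, d[) (G y)%:E)%E.
  apply: (@cvg_integral_exhaust R c d (F \o u) (F \o v)) => //.
  - by move=> m n mn /=; apply: incFle => //; exact: ndu.
  - by move=> m n mn /=; apply: incFle => //; exact: ndv.
  - by move=> n /=; case/andP: (FI _ (uab n)).
  - by move=> n /=; case/andP: (FI _ (vab n)).
  - move=> y /Fsurj[t tab <-]; have [n /andP[unt tvn]] := exh _ tab.
    by exists n => /=; rewrite !incFle.
(* Term by term, the sequence converging to the left-hand side is also the one converging to the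
   right-hand side. *)
apply: (cvg_unique _ cvgG) => //=; rewrite [X in X @ _ --> _](_ : _ = fun n =>
    (\int[@lebesgue_measure R]_(t in `[u n, v n]) (G (F t) * f t)%:E)%E).
  apply: (@cvg_integral_exhaust R a b u v) => //.
  - by move=> n; case/andP: (uab n).
  - by move=> n; case/andP: (vab n).
  - move=> t tab; apply: continuousM; last exact: cf.
    apply: continuous_comp; first exact: cF.
    by apply: cG; rewrite in_itv/= FI//; move: tab; rewrite in_itv.
  - by move=> t tab; rewrite mulr_ge0// ?G0 ?FI// ltW// f0.
apply/funext => n; have [/andP[_ uvn] _] := uv n.
rewrite integration_by_substitution_increasing; last first.
- apply: continuous_in_subspaceT => y; rewrite inE/= in_itv/= => /andP[uy yv].
  apply: cG; rewrite in_itv/=.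
  case/andP: (FI _ (uab n)) => cu _; case/andP: (FI _ (vab n)) => _ vd.
  by rewrite (lt_le_trans cu uy) (le_lt_trans yv vd).
- split.
  + by move=> t /subset_itv_oo_cc/sub tab; have [] := dF t tab.
  + by apply: cvg_at_right_filter; apply: cF; rewrite in_itv/= uab.
  + by apply: cvg_at_left_filter; apply: cF; rewrite in_itv/= vab.
- apply/cvg_ex; exists (F^`()%classic (v n)).
  by apply: cvg_at_left_filter; apply: cF'; rewrite in_itv/= vab.
- apply/cvg_ex; exists (F^`()%classic (u n)).
  by apply: cvg_at_right_filter; apply: cF'; rewrite in_itv/= uab.
- move=> t tuv; apply: cF'; rewrite in_itv/=; apply: (sub n).
  exact: subset_itv_oo_cc tuv.
- by move=> s t /sub sab /sub tab; apply: incF; rewrite in_itv.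
- exact: uvn.
- apply: eq_integral => t; rewrite inE/= => tuv.
  by rewrite fctE F'E//; apply: (sub n).
Unshelve. all: end_near. Qed.

(** The open interval leaves out the endpoint values, which are mere conventions; values in the
    extended reals allow Tonelli and additivity before finiteness is known. *)
Definition int01 (R : realType) (g : R -> R) : \bar R :=
  (\int[@lebesgue_measure R]_(u in `]0%R, 1%R[) (g u)%:E)%E.

(** The reflection is decreasing, hence not covered by the previous substitution lemma; the same
    exhaustion argument applies. *)
Lemma int01_onem (R : realType) (G : R -> R) :
  {in `]0, 1[, continuous G} -> (forall y, 0 < y < 1 -> 0 <= G y) ->
  int01 G = int01 (fun t => G (1 - t)).
Proof.
move=> cG G0; have [u [v [ndu ndv uv exh]]] := itv_exhaust (@ltr01 R).
have u0 n : 0 < u n by case: (uv n) => /andP[].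
have v1 n : v n < 1 by case: (uv n).
have cvgG := @cvg_integral_exhaust R 0 1 u v G ndu ndv u0 v1 exh cG G0.
apply: (cvg_unique _ cvgG) => //=; rewrite [X in X @ _ --> _](_ : _ = fun n =>
    (\int[@lebesgue_measure R]_(t in `[(1 - v n)%R, (1 - u n)%R]) (G (1 - t))%:E)%E).
  apply: (@cvg_integral_exhaust R 0 1 (fun n => 1 - v n) (fun n => 1 - u n)
    (fun t => G (1 - t))).
  - by move=> m n mn; rewrite lerD2l lerN2 ndv.
  - by move=> m n mn; rewrite lerD2l lerN2 ndu.
  - by move=> n; rewrite subr_gt0.
  - by move=> n; rewrite ltrBlDr ltrDl.
  - move=> y y01; have [|n /andP[? ?]] := exh (1 - y); first by lra.
    by exists n; lra.
  - move=> t; rewrite in_itv/= => t01; apply: (@continuous_comp _ _ _ (fun t : R => 1 - t) G).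
      by apply: continuousB; [exact: cst_continuous|exact: cvg_id].
    by apply: cG; rewrite in_itv/=; lra.
  - by move=> t t01; apply: G0; lra.
apply/funext => n; have [/andP[_ uvn] _] := uv n.
have := @integration_by_substitution_decreasing R (fun t => 1 - t) G (1 - v n) (1 - u n).
have D1 : (fun t : R => 1 - t)^`()%classic = cst (-1).
  apply/funext => t; rewrite derive1E deriveB//= derive_cst derive_id sub0r//.
rewrite !subKr D1 => -> //.
- by apply: eq_integral => t _; rewrite !fctE opprK mulr1.
- by rewrite lerD2l lerN2.
- by move=> s t _ _ st; rewrite ltrD2l ltrN2.
- by move=> ? ?; exact: cvg_cst.
- exact: is_cvg_cst.
- exact: is_cvg_cst.
- have cB (t : R) : {for t, continuous (fun t : R => 1 - t)}.
    by apply: continuousB; [exact: cst_continuous|exact: cvg_id].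
  split; first by move=> t _; exact: derivableB.
    exact/cvg_at_right_filter/cB.
  exact/cvg_at_left_filter/cB.
- apply: continuous_in_subspaceT => y; rewrite inE/= in_itv/= => /andP[uy yv].
  by apply: cG; rewrite in_itv/= (lt_le_trans _ uy)// (le_lt_trans yv).
Qed.

(** * Euler integrals *)

Lemma continuous_powR_comp (R : realType) (F : R -> R) (a t : R) :
  0 < F t -> {for t, continuous F} -> {for t, continuous (fun s => F s `^ a)}.
Proof.
move=> Ft0 cF; apply: (@continuous_comp _ _ _ F (fun y => y `^ a)) => //.
apply: differentiable_continuous; apply/derivable1_diffP.
by apply: derivable_powR; rewrite in_itv/= Ft0.
Qed.

Lemma measurable_powR_comp d (T : measurableType d) (R : realType)
    (D : set T) (g : T -> R) (a : R) :
  measurable_fun D g -> measurable_fun D (fun t => g t `^ a).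
Proof.
by move=> mg; apply: (measurableT_comp (@measurable_powR R a)).
Qed.

(** * Nonnegative integrals over the open unit interval *)

Section int01_theory.
Variable R : realType.
Implicit Types f g : R -> R.

Lemma eq_int01 f g : (forall u, 0 < u < 1 -> f u = g u) -> int01 f = int01 g.
Proof.
move=> fg; apply: eq_integral => u; rewrite inE/= in_itv/= => u01.
by rewrite fg.
Qed.

Lemma le_int01 f g : measurable_fun setT f -> measurable_fun setT g ->
  (forall u, 0 < u < 1 -> 0 <= f u <= g u) -> (int01 f <= int01 g)%E.
Proof.
move=> mf mg fg; apply: ge0_le_integral => //.
- by move=> u; rewrite /= in_itv/= lee_fin => /fg/andP[].
- by apply/measurable_EFinP; apply: measurable_funS mf.
- by apply/measurable_EFinP; apply: measurable_funS mg.
- by move=> u; rewrite /= in_itv/= lee_fin => /fg/andP[].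
Qed.

Lemma int01D f g : measurable_fun setT f -> measurable_fun setT g ->
  (forall u, 0 < u < 1 -> 0 <= f u) -> (forall u, 0 < u < 1 -> 0 <= g u) ->
  int01 (fun u => f u + g u) = (int01 f + int01 g)%E.
Proof.
move=> mf mg f0 g0; rewrite /int01 -ge0_integralD//.
- by apply/measurable_EFinP; apply: measurable_funS mf.
- by apply/measurable_EFinP; apply: measurable_funS mg.
Qed.

Lemma int01Zl f c : measurable_fun setT f -> (forall u, 0 < u < 1 -> 0 <= f u) ->
  0 <= c -> int01 (fun u => c * f u) = (c%:E * int01 f)%E.
Proof.
move=> mf f0 c0; rewrite /int01 -ge0_integralZl//.
by apply/measurable_EFinP; apply: measurable_funS mf.
Qed.

Lemma int01_ge0 f : (forall u, 0 < u < 1 -> 0 <= f u) -> (0 <= int01 f)%E.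
Proof.
by move=> f0; apply: integral_ge0 => u; rewrite /= in_itv/= lee_fin => /f0.
Qed.

(** If the integral were 0, [f] would vanish almost everywhere, and the exceptional null set would
    contain []0, 1[], which has measure 1. *)
Lemma int01_gt0 f : measurable_fun setT f -> (forall u, 0 < u < 1 -> 0 < f u) ->
  (0 < int01 f)%E.
Proof.
move=> mf f0; have f0' u : 0 < u < 1 -> 0 <= f u by move=> /f0/ltW.
rewrite lt0e int01_ge0// andbT; apply/eqP => if0.
have mEf : measurable_fun [set` `]0, (1 : R)[] (EFin \o f).
  by apply/measurable_EFinP; apply: measurable_funS mf.
have [+ _] := ae_eq_integral_abs (@lebesgue_measure R) (measurable_itv _) mEf.
case.
  rewrite -[RHS]if0; apply: eq_integral => u; rewrite inE/= in_itv/= => u01.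
  by rewrite ger0_norm// f0'.
move=> N [mN N0 sub].
have : (@lebesgue_measure R `]0%R, 1%R[ <= lebesgue_measure N)%E.
  apply: le_measure; rewrite ?inE// => u /=; rewrite in_itv/= => u01; apply: sub => /=.
  by rewrite in_itv/= => /(_ u01)[]; apply/eqP; rewrite gt_eqF// f0.
by rewrite N0 lebesgue_measure_itv/= lte_fin ltr01 oppr0 adde0 lee_fin ler10.
Qed.

Lemma Rintegral01E f : measurable_fun setT f ->
  \int[@lebesgue_measure R]_(t in `[0, 1]) f t = fine (int01 f).
Proof.
move=> mf; rewrite /Rintegral integral_itv_bndoo//.
by apply/measurable_EFinP; apply: measurable_funS mf.
Qed.

End int01_theory.

(** Euler's integrand for the hypergeometric function: its integral is B(x, 1-a) 2F1(-e, x; x+1-a;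
    m). For e = 0 it reduces to the integrand of B(x, 1-a). *)
Definition hgker (R : realType) (x a e m u : R) : R :=
  u `^ (x - 1) * (1 - u) `^ (- a) * (1 - m * u) `^ e.

Section hgker_theory.
Variable R : realType.
Implicit Types x a e m u q t : R.

Lemma onem_mul_gt0 m u : m < 1 -> 0 < u < 1 -> 0 < 1 - m * u.
Proof.
move=> m1 /andP[u0 u1]; rewrite subr_gt0; have [m0|m0] := ltP 0 m.
  by rewrite -[ltRHS]mulr1 ltr_pM// ltW.
by rewrite (le_lt_trans _ ltr01)// mulr_le0_ge0// ltW.
Qed.

Lemma hgker_gt0 x a e m u : m < 1 -> 0 < u < 1 -> 0 < hgker x a e m u.
Proof.
move=> m1 u01; have D0 := onem_mul_gt0 m1 u01; case/andP: u01 => u0 u1.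
by rewrite !mulr_gt0// powR_gt0// subr_gt0.
Qed.

Lemma continuous_hgker x a e m : m < 1 ->
  {in `]0, 1[, continuous (hgker x a e m)}.
Proof.
move=> m1 u; rewrite in_itv/= => u01; have D0 := onem_mul_gt0 m1 u01.
case/andP: u01 => u0 u1.
have c1 : {for u, continuous (fun v : R => v `^ (x - 1))}.
  by apply: continuous_powR_comp => //; exact: cvg_id.
have c2 : {for u, continuous (fun v : R => (1 - v) `^ (- a))}.
  apply: continuous_powR_comp; rewrite ?subr_gt0//.
  by apply: continuousB; [exact: cst_continuous|exact: cvg_id].
have c3 : {for u, continuous (fun v : R => (1 - m * v) `^ e)}.
  apply: continuous_powR_comp => //; apply: continuousB.
    exact: cst_continuous.
  by apply: continuousM; [exact: cst_continuous|exact: cvg_id].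
exact: (continuousM (continuousM c1 c2) c3).
Qed.

Lemma measurable_hgker x a e m : measurable_fun setT (hgker x a e m).
Proof.
by repeat (apply: measurable_funM || apply: measurable_funB ||
  apply: measurable_powR_comp || apply: measurable_id || apply: measurable_cst).
Qed.

Lemma powR_itv01 q t : 0 < q -> 0 < t < 1 -> 0 < t `^ q < 1.
Proof.
move=> q0 /andP[t0 t1]; have E : 1 `^ q = 1 :> R by rewrite powR1.
by rewrite powR_gt0//= -[ltRHS]E gt0_ltr_powR// nnegrE ltW.
Qed.

(** Substitution u = t^q: the factor u^(1/q-1) cancels the t^(q-1) of the derivative. *)
Lemma int01_powR_subst a e m q : m < 1 -> 0 < q ->
  int01 (hgker q^-1 a e m) =
  (q%:E * int01 (fun t => ((1 - t `^ q) `^ (- a) * (1 - m * t `^ q) `^ e)%R))%E.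
Proof.
move=> m1 q0; have qN0 : q != 0 by rewrite gt_eqF.
rewrite -int01Zl ?ltW//.
- transitivity (int01 (fun t => hgker q^-1 a e m (t `^ q) * (q * t `^ (q - 1)))).
    apply: (@ge0_integration_by_substitution_oo R (fun t => t `^ q)) => //.
  + by move=> t; exact: powR_itv01.
  + move=> y y01; exists (y `^ q^-1); first by rewrite powR_itv01 ?invr_gt0.
    case/andP: y01 => y0 _; by rewrite -powRrM mulVf// powRr1// ltW.
  + by move=> t /andP[t0 _]; exact: is_derive1_powR.
  + move=> t; rewrite in_itv/= => /andP[t0 _].
    have c1 : {for t, continuous (fun s : R => s `^ (q - 1))}.
      by apply: continuous_powR_comp => //; exact: cvg_id.
    by apply: (continuousM _ c1); exact: cst_continuous.
  + by move=> t /andP[t0 _]; rewrite mulr_gt0// powR_gt0.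
  + exact: continuous_hgker.
  + by move=> y y01; rewrite ltW// hgker_gt0.
  + apply: eq_int01 => t /andP[t0 t1]; rewrite /hgker -powRrM.
    rewrite -!mulrA; set A := (1 - t `^ q) `^ _; set B := (1 - m * _) `^ _.
    have : t `^ (q * (q^-1 - 1)) * t `^ (q - 1) = 1.
      rewrite -powRD; last by rewrite (gt_eqF t0) implybT.
      by have -> : q * (q^-1 - 1) + (q - 1) = 0; [field|rewrite powRr0].
    by move=> E; transitivity (q * (A * B) * (t `^ (q * (q^-1 - 1)) * t `^ (q - 1)));
      [ring|rewrite E mulr1].
- by repeat (apply: measurable_funM || apply: measurable_funB ||
  apply: measurable_powR_comp || apply: measurable_id || apply: measurable_cst).
- by move=> t _; rewrite mulr_ge0// powR_ge0.
Qed.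

End hgker_theory.

Lemma divr_powR (R : realType) (x y b : R) : 0 <= x -> 0 < y ->
  (x / y) `^ b = x `^ b * y `^ (- b).
Proof.
move=> x0 y0; rewrite powRM ?invr_ge0 ?(ltW y0)//.
by rewrite -(powR_inv1 (ltW y0)) -powRrM mulN1r.
Qed.

Lemma lt0_gtr_powR (R : realType) (e x y : R) : e < 0 -> 0 < x < y ->
  y `^ e < x `^ e.
Proof.
move=> e0 /andP[x0 xy]; have y0 := lt_trans x0 xy.
rewrite -[e]opprK powRN [ltRHS]powRN ltf_pV2 ?posrE ?powR_gt0//.
by rewrite gt0_ltr_powR ?oppr_gt0// nnegrE ltW.
Qed.

Lemma powR_itvcc01 (R : realType) (e u : R) : 0 <= e -> 0 <= u <= 1 -> u `^ e <= 1.
Proof.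
move=> e0 /andP[u0 u1]; have E : 1 `^ e = 1 :> R by rewrite powR1.
by rewrite -[leRHS]E; apply: ge0_ler_powR; rewrite ?nnegrE.
Qed.

(** * Finiteness of Euler integrals and Euler's transformation *)

Section hgker_integral.
Variable R : realType.
Implicit Types x y a e m u : R.

(** Substituting t^x in the integral of the constant 1 shows that [x] times this integral is 1,
    which excludes [+oo]. *)
Lemma int01_powR_lty x : 0 < x -> (int01 (fun u : R => (u `^ (x - 1))%R) < +oo)%E.
Proof.
move=> x0; have mx : measurable_fun setT (fun u : R => u `^ (x - 1)).
  by apply: measurable_powR_comp; exact: measurable_id.
suff : (x%:E * int01 (fun u : R => (u `^ (x - 1))%R) = 1%:E)%E.
  case: (int01 _) => [r| |]//; last by rewrite gt0_muley ?lte_fin.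
  by rewrite ltry.
rewrite -int01Zl ?ltW//; last by move=> u _; exact: powR_ge0.
transitivity (int01 (fun u : R => cst 1 (u `^ x) * (x * u `^ (x - 1)))).
  by apply: eq_int01 => u _; rewrite /= mul1r.
transitivity (int01 (cst (1 : R))); last first.
  have E : (int01 (cst (1%R : R)) = 1%:E * @lebesgue_measure R `]0%R, 1%R[)%E.
    transitivity (\int[@lebesgue_measure R]_(u in `]0%R, 1%R[) cst 1%:E u)%E => //.
    by rewrite integral_cst.
  rewrite E; by rewrite lebesgue_measure_itv/= lte_fin ltr01 oppr0 adde0 mule1.
apply/esym; apply: (@ge0_integration_by_substitution_oo R (fun t => t `^ x)) => //.
- by move=> t; exact: powR_itv01.
- move=> y y01; exists (y `^ x^-1); first by rewrite powR_itv01 ?invr_gt0.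
  by case/andP: y01 => y0 _; rewrite -powRrM mulVf ?gt_eqF// powRr1// ltW.
- by move=> t /andP[t0 _]; exact: is_derive1_powR.
- move=> t; rewrite in_itv/= => /andP[t0 _].
  have c1 : {for t, continuous (fun s : R => s `^ (x - 1))}.
    by apply: continuous_powR_comp => //; exact: cvg_id.
  by apply: (continuousM _ c1); exact: cst_continuous.
- by move=> t /andP[t0 _]; rewrite mulr_gt0// powR_gt0.
- by move=> t _; exact: cst_continuous.
Qed.

Lemma int01_hgker_lty x a e m : 0 < x -> a < 1 -> 0 <= m < 1 ->
  (int01 (hgker x a e m) < +oo)%E.
Proof.
move=> x0 a1 /andP[m0 m1].
have mx : measurable_fun setT (fun u : R => u `^ (x - 1)).
  by apply: measurable_powR_comp; exact: measurable_id.
have ma : measurable_fun setT (fun u : R => (1 - u) `^ (- a)).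
  apply: measurable_powR_comp; apply: measurable_funB.
    exact: measurable_cst.
  exact: measurable_id.
(* [C] bounds (1-mu)^e for either sign of [e]: by 1 if e >= 0, by (1-m)^e otherwise. *)
pose C : R := 1 + (1 - m) `^ e.
have C0 : 0 <= C by rewrite addr_ge0// powR_ge0.
apply: (@le_lt_trans _ _
    (int01 (fun u => C * (u `^ (x - 1) + (1 - u) `^ (- a))))).
  apply: le_int01; first exact: measurable_hgker.
    by apply: measurable_funM; [exact: measurable_cst|exact: measurable_funD].
  move=> u u01; rewrite ltW ?hgker_gt0//=; have D0 := onem_mul_gt0 m1 u01.
  case/andP: u01 => u0 u1; have v0 : 0 < 1 - u by rewrite subr_gt0.
  rewrite /hgker [leRHS]mulrC ler_pM ?mulr_ge0 ?powR_ge0//.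
    (* Multiplying by 1 = u + (1-u) separates the two endpoint singularities into a sum of
       integrable powers. *)
    have E : u `^ (x - 1) * (1 - u) `^ (- a) =
        u `^ x * (1 - u) `^ (- a) + u `^ (x - 1) * (1 - u) `^ (1 - a).
      rewrite -(mulr_powRB1 (ltW u0) x0).
      rewrite -(@mulr_powRB1 _ (1 - u) (1 - a) (ltW v0)) ?subr_gt0//.
      have -> : 1 - a - 1 = - a by ring.
      by ring.
    rewrite E addrC lerD//.
      rewrite -[leRHS]mulr1 ler_wpM2l ?powR_ge0//.
      by rewrite powR_itvcc01 ?subr_ge0 ?(ltW a1) ?(ltW u1)// gerBl ltW.
    rewrite -[leRHS]mul1r ler_wpM2r ?powR_ge0//.
    by rewrite powR_itvcc01 ?(ltW x0) ?(ltW u0) ?(ltW u1).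
  rewrite /C; have [e0|e0] := leP 0 e.
    apply: ler_wpDr; first exact: powR_ge0.
    by rewrite powR_itvcc01 ?(ltW D0)// gerBl mulr_ge0// ltW.
  apply: ler_wpDl => //; have : 1 - m <= 1 - m * u.
    by rewrite lerD2l lerN2 ler_piMr// ltW.
  rewrite le_eqVlt => /predU1P[->//|h]; apply/ltW/lt0_gtr_powR => //.
  by rewrite h subr_gt0 m1.
rewrite int01Zl//; first last.
- by move=> u _; rewrite addr_ge0 ?powR_ge0.
- exact: measurable_funD.
rewrite int01D//; try by move=> u _; exact: powR_ge0.
have fx := int01_powR_lty x0.
have fa : (int01 (fun u : R => ((1 - u) `^ (- a))%R) < +oo)%E.
  have a0 : 0 < 1 - a by rewrite subr_gt0.
  have := int01_powR_lty a0; rewrite int01_onem.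
  - by have -> : 1 - a - 1 = - a by ring.
  - move=> u; rewrite in_itv/= => /andP[u0 _].
    by apply: continuous_powR_comp => //; exact: cvg_id.
  - by move=> u _; exact: powR_ge0.
apply: lte_mul_pinfty; [by rewrite lee_fin|by []|exact: lte_add_pinfty].
Qed.

Lemma int01_hgker_fin x a e m : 0 < x -> a < 1 -> 0 <= m < 1 ->
  int01 (hgker x a e m) \is a fin_num.
Proof.
move=> x0 a1 m01; rewrite ge0_fin_numE ?int01_hgker_lty// int01_ge0//.
by move=> u u01; rewrite ltW// hgker_gt0//; case/andP: m01.
Qed.

(** With u = w/(1-m+mw) one has 1-u = (1-m)(1-w)/(1-m+mw), 1-mu = (1-m)/(1-m+mw) and du =
    (1-m)/(1-m+mw)^2 dw. The exponents of 1-m add up to y-a, those of 1-m+mw to a-x-y. *)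
Lemma int01_Euler x y a m : 0 <= m < 1 ->
  int01 (hgker x a (y - 1) m) = (((1 - m) `^ (y - a))%:E *
  int01 (fun w => (w `^ (x - 1) * (1 - w) `^ (- a) *
                  (1 - m + m * w) `^ (a - x - y))%R))%E.
Proof.
move=> /andP[m0 m1]; set n := 1 - m; have n0 : 0 < n by rewrite subr_gt0.
have E0 w : 0 < w < 1 -> 0 < n + m * w.
  by move=> /andP[w0 w1]; rewrite ltr_wpDr// mulr_ge0// ltW.
rewrite -int01Zl ?powR_ge0//; first last.
- by move=> w _; rewrite !mulr_ge0 ?powR_ge0.
- by repeat (apply: measurable_funM || apply: measurable_funB ||
  apply: measurable_funD || apply: measurable_powR_comp ||
  apply: measurable_id || apply: measurable_cst).
pose F w : R := w / (n + m * w).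
transitivity (int01 (fun w => hgker x a (y - 1) m (F w) * (n * (n + m * w) `^ (- 2)))).
  apply: ge0_integration_by_substitution_oo => //.
  - move=> w w01; have w0 := E0 _ w01; case/andP: w01 => ? ?.
    rewrite divr_gt0//= ltr_pdivrMr// mul1r -subr_gt0.
    have -> : n + m * w - w = n * (1 - w) by rewrite /n; ring.
    by rewrite mulr_gt0// subr_gt0.
  - move=> u u01; have D0 := onem_mul_gt0 m1 u01; case/andP: u01 => u0 u1.
    have D0' : 1 - m * u != 0 by rewrite gt_eqF.
    have N0 : n != 0 by rewrite gt_eqF.
    (* The inverse map is w = (1-m)u/(1-mu). *)
    exists (n * u / (1 - m * u)); last by rewrite /F; field; rewrite D0'/= mulrBr; lra.
    rewrite divr_gt0 ?mulr_gt0//= ltr_pdivrMr// mul1r -subr_gt0.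
    have -> : 1 - m * u - n * u = 1 - u by rewrite /n; ring.
    by rewrite subr_gt0.
  - move=> w w01; have h : n + m * w != 0 by rewrite gt_eqF ?E0.
    apply: is_derive_eq; rewrite /GRing.scale/= powRN powR_mulrn ?ltW ?E0//.
    by field.
  - move=> w; rewrite in_itv/= => w01.
    have c1 : {for w, continuous (fun t : R => (n + m * t) `^ (- 2))}.
      apply: continuous_powR_comp; first exact: E0.
      apply: continuousD; first exact: cst_continuous.
      by apply: continuousM; [exact: cst_continuous|exact: cvg_id].
    by apply: (continuousM _ c1); exact: cst_continuous.
  - by move=> w w01; rewrite mulr_gt0// powR_gt0// E0.
  - exact: continuous_hgker.
  - by move=> u u01; rewrite ltW// hgker_gt0.
apply: eq_int01 => w w01; have h := E0 _ w01; case/andP: w01 => w0 w1.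
have h0 : n + m * w != 0 by rewrite gt_eqF.
have v0 : 0 < 1 - w by rewrite subr_gt0.
rewrite /hgker /F.
have -> : 1 - w / (n + m * w) = n * (1 - w) / (n + m * w) by rewrite /n; field.
have -> : 1 - m * (w / (n + m * w)) = n / (n + m * w) by rewrite /n; field.
rewrite !divr_powR ?mulr_ge0 ?(ltW w0) ?(ltW n0) ?(ltW v0)//.
rewrite powRM ?(ltW n0) ?(ltW v0)//.
set D := n + m * w.
have ED : D `^ (a - x - y) = D `^ (- (x - 1)) * D `^ (- - a) * D `^ (- (y - 1)) * D `^ (- 2).
  rewrite -!powRD ?(gt_eqF h) ?implybT//; congr (_ `^ _); ring.
have En : n `^ (y - a) = n `^ (- a) * n `^ (y - 1) * n.
  by rewrite -{4}(powRr1 (ltW n0)) -!powRD ?(gt_eqF n0) ?implybT//; congr (_ `^ _); ring.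
by rewrite ED En; ring.
Qed.

End hgker_integral.

(** * The change of variables onto the simplex *)

Section Elliott.
Variables (R : realType) (x y a m : R).
Hypotheses (m01 : 0 < m < 1).
Let n := 1 - m.
Let mu := @lebesgue_measure R.

(** This is X = u(1-nv) with v eliminated through Y = v(1-mu). The planar map is split as (u,v) ->
    (u,Y) -> (X,Y), so that one-dimensional substitutions and Tonelli's theorem suffice. Inverses
    are written as real powers so that measurability follows from that of [powR]. *)
Let h (u Y : R) := u * (1 - n * Y * (1 - m * u) `^ (- 1)).
(** The partial derivative of [h] in [u] at fixed [Y]. *)
Let jac (u Y : R) := 1 - n * Y * (1 - m * u) `^ (- 2).
(** The Dirichlet integrand Y^(y-1) X^(x-1) (1-X-Y)^(-a) at X = [h u Y], times the Jacobian of (u,Y)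
    -> (X,Y). *)
Let psi (u Y : R) :=
  Y `^ (y - 1) * (h u Y `^ (x - 1) * (1 - Y - h u Y) `^ (- a)) * jac u Y.
(** Extension by 0 to the whole plane, so that the dependent bound Y < 1-mu does not hinder the
    exchange of integrals. *)
Let W (z : R * R) : R :=
  if (0 < z.1) && (z.1 < 1) && ((0 < z.2) && (z.2 < 1 - m * z.1))
  then psi z.1 z.2 else 0.

Let m0 : 0 < m. Proof. by case/andP: m01. Qed.
Let m1 : m < 1. Proof. by case/andP: m01. Qed.
Let n0 : 0 < n. Proof. by rewrite subr_gt0. Qed.
Let n1 : n < 1. Proof. by rewrite ltrBlDr ltrDl. Qed.

Let D_gt u : 0 < u < 1 -> n < 1 - m * u.
Proof. by move=> /andP[u0 u1]; rewrite ltrD2l ltrN2 gtr_pMr. Qed.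

Let inv_D u : 0 < u < 1 -> (1 - m * u) `^ (- 1) = (1 - m * u)^-1.
Proof. by move=> u01; rewrite powR_inv1// ltW// onem_mul_gt0. Qed.

Let inv_D2 u : 0 < u < 1 -> (1 - m * u) `^ (- 2) = ((1 - m * u) ^+ 2)^-1.
Proof. by move=> u01; rewrite powRN powR_mulrn// ltW// onem_mul_gt0. Qed.

(** Both n and Y are below 1-mu, hence nY < (1-mu)^2. *)
Let jac_gt0 u Y : 0 < u < 1 -> 0 < Y < 1 - m * u -> 0 < jac u Y.
Proof.
move=> u01 /andP[Y0 YD]; rewrite /jac inv_D2// subr_gt0.
have D0 := onem_mul_gt0 m1 u01; rewrite ltr_pdivrMr ?exprn_gt0// mul1r expr2.
by rewrite ltr_pM ?(ltW n0) ?(ltW Y0)// D_gt.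
Qed.

Let h_gt0 u Y : 0 < u < 1 -> 0 < Y < 1 - m * u -> 0 < h u Y.
Proof.
move=> u01 /andP[Y0 YD]; have D0 := onem_mul_gt0 m1 u01.
rewrite /h inv_D// mulr_gt0//; first by case/andP: u01.
rewrite subr_gt0 ltr_pdivrMr// mul1r (lt_trans _ YD)//.
by rewrite gtr_pMl.
Qed.

Let onem_h u Y : 0 < u < 1 ->
  1 - Y - h u Y = (1 - u) * (1 - Y / (1 - m * u)).
Proof.
move=> u01; have /lt0r_neq0 D0 := onem_mul_gt0 m1 u01.
by rewrite /h inv_D// /n; field.
Qed.

Let onem_h_gt0 u Y : 0 < u < 1 -> 0 < Y < 1 - m * u -> 0 < 1 - Y - h u Y.
Proof.
move=> u01 /andP[Y0 YD]; have D0 := onem_mul_gt0 m1 u01; rewrite onem_h//.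
rewrite mulr_gt0// subr_gt0; first by case/andP: u01.
by rewrite ltr_pdivrMr// mul1r.
Qed.

Let W_ge0 z : 0 <= W z.
Proof.
rewrite /W; case: ifPn => // /andP[u01 YD].
by rewrite /psi !mulr_ge0 ?powR_ge0// ltW// jac_gt0.
Qed.

Let measurable_W : measurable_fun setT W.
Proof.
apply: measurable_fun_ifT; last exact: measurable_cst.
  by repeat (apply: measurable_and || apply: measurable_fun_ltr ||
  apply: measurable_funM || apply: measurable_funB || apply: measurable_fst ||
  apply: measurable_snd || apply: measurable_cst).
by rewrite /psi /jac /h; repeat (
  apply: measurable_funM || apply: measurable_funB ||
  apply: measurable_powR_comp || apply: measurable_fst ||
  apply: measurable_snd || apply: measurable_cst).
Qed.

(* Substitution Y = v (1-mu) at fixed u. *)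
Let integral_W_Y u : 0 < u < 1 ->
  (\int[mu]_Y (W (u, Y))%:E = (hgker x a (y - 1) m u)%:E *
    int01 (fun v => (hgker y a (x - 1) n v * (1 - m * u - n * v))%R))%E.
Proof.
move=> u01; have D0 := onem_mul_gt0 m1 u01; have /lt0r_neq0 DN0 := D0.
set D := 1 - m * u in D0 DN0 *.
have D1 v : 0 < v < 1 -> 0 < D - n * v.
  move=> /andP[v0 v1]; rewrite subr_gt0 (lt_trans _ (D_gt u01))//.
  by rewrite gtr_pMr.
have g0 v : 0 < v < 1 -> 0 <= hgker y a (x - 1) n v * (D - n * v).
  by move=> v01; rewrite mulr_ge0// ltW ?hgker_gt0// D1.
have YD Y : 0 < Y < D -> 0 < Y / D < 1.
  by move=> /andP[Y0 YD]; rewrite divr_gt0//= ltr_pdivrMr// mul1r.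
have -> : int01 (fun v => hgker y a (x - 1) n v * (D - n * v)) =
  (\int[mu]_(Y in `]0%R, D[)
    (hgker y a (x - 1) n (Y / D) * (D - n * (Y / D)) * D^-1)%:E)%E.
  apply: (@ge0_integration_by_substitution_oo R (fun Y => Y / D)
    (fun=> D^-1) (fun v => hgker y a (x - 1) n v * (D - n * v))) => //.
  - move=> v /andP[v0 v1]; exists (v * D); last by rewrite mulfK.
    by rewrite mulr_gt0//= gtr_pMl.
  - by move=> Y _; apply: is_derive_eq; rewrite /GRing.scale/=; ring.
  - by move=> Y _; exact: cst_continuous.
  - by move=> Y _; rewrite invr_gt0.
  - move=> v v01; have c1 : {for v, continuous (hgker y a (x - 1) n)}.
      exact: continuous_hgker.
    have c2 : {for v, continuous (fun v : R => D - n * v)}.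
      apply: continuousB; first exact: cst_continuous.
      by apply: continuousM; [exact: cst_continuous|exact: cvg_id].
    exact: (continuousM c1 c2).
rewrite -ge0_integralZl//; last 3 first.
- apply/measurable_EFinP; apply: (@measurable_funS _ _ _ _ setT) => //.
  rewrite /hgker; repeat (
  apply: measurable_funM || apply: measurable_funB ||
  apply: measurable_powR_comp || apply: measurable_id ||
  apply: measurable_cst).
- move=> Y; rewrite /= in_itv/= lee_fin => /YD /g0 g0Y.
  by rewrite mulr_ge0// invr_ge0 ltW.
- by rewrite lee_fin ltW// hgker_gt0.
rewrite [RHS]integral_mkcond; apply: eq_integral => Y _.
rewrite patchE mem_setE in_itv/= /W/= u01/= -/D; case: ifPn => // Y0D.
rewrite -EFinM; congr EFin.
have /andP[v0 v1] := YD _ Y0D; case/andP: (u01) => u0 u1.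
rewrite /psi onem_h// /h /jac inv_D// inv_D2// -/D /hgker -/D.
(* Writing Y = vD leaves only an identity between powers of u, 1-u, v, 1-v, D and 1-nv. *)
have YE : Y = Y / D * D by rewrite divfK.
move: (Y / D) v0 v1 YE => v v0 v1 ->.
have nv0 : 0 < 1 - n * v by rewrite onem_mul_gt0 ?v0.
have -> : 1 - n * (v * D) * D^-1 = 1 - n * v by field.
have -> : 1 - n * (v * D) * (D ^+ 2)^-1 = (D - n * v) / D by field.
have u1' : 0 < 1 - u by rewrite subr_gt0.
have v1' : 0 < 1 - v by rewrite subr_gt0.
rewrite !powRM ?(ltW v0) ?(ltW v1') ?(ltW u0) ?(ltW u1') ?(ltW D0) ?(ltW nv0)//.
ring.
Qed.

(* Substitution w = X/(1-Y) at fixed Y; the bound b is where u = 1 or v = 1. *)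
Let integral_W_u Y : 0 < Y < 1 ->
  (\int[mu]_u (W (u, Y))%:E =
   (hgker y (a - x) 0 0 Y)%:E * int01 (hgker x a 0 0))%E.
Proof.
move=> /andP[Y0 Y1]; have Z0 : 0 < 1 - Y by rewrite subr_gt0.
have ZN0 := lt0r_neq0 Z0; have mN0 := lt0r_neq0 m0.
pose b := Num.min 1 ((1 - Y) / m).
have b0 : 0 < b by rewrite lt_min ltr01/= divr_gt0.
(* The interval []0, b[] is the slice at height [Y] of the support of [W]. *)
have bP u : (0 < u < b) = (0 < u < 1) && (Y < 1 - m * u).
  rewrite lt_min ltr_pdivlMr// andbA; congr (_ && _).
  by rewrite ltrBrDr addrC -ltrBrDr mulrC.
pose F u : R := u * (1 - n * Y / (1 - m * u)) / (1 - Y).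
have DN u : 0 <= u <= b -> 1 - m * u != 0.
  move=> /andP[u0 ub]; apply: lt0r_neq0; rewrite subr_gt0.
  have u1 : u <= 1 by rewrite (le_trans ub)// ge_min lexx.
  by rewrite (le_lt_trans _ m1)// ger_pMr.
have dF u : 0 <= u <= b -> is_derive u 1 F
    ((1 - n * Y / (1 - m * u) ^+ 2) / (1 - Y)).
  move=> ub; have DN0 := DN _ ub; rewrite /F.
  by apply: is_derive_eq; rewrite /GRing.scale/= /n; field; rewrite ZN0.
have Fh u : 0 < u < 1 -> F u = h u Y / (1 - Y).
  by move=> u01; rewrite /h inv_D.
have F01 u : 0 < u < b -> 0 < F u < 1.
  rewrite bP => /andP[u01 YD]; have YD' : 0 < Y < 1 - m * u by rewrite Y0.
  rewrite Fh// divr_gt0 ?h_gt0//= ltr_pdivrMr// mul1r -subr_gt0.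
  exact: onem_h_gt0.
have F_0 : F 0 = 0 by rewrite /F !mul0r.
have F_b : F b = 1.
  have bD : 1 - m * b != 0 by apply: DN; rewrite lexx ltW.
  rewrite /F; move: bD; rewrite /b; case: leP => _ bD.
    by move: bD; rewrite mulr1 -/n => nN0; field; rewrite nN0 ZN0.
  (* If b = (1-Y)/m, then 1-mb = Y, so F(b) = b(1-n)/(1-Y) = bm/(1-Y) = 1. *)
  have E : 1 - m * ((1 - Y) / m) = Y by field.
  by rewrite E mulfK ?gt_eqF// /n; field; rewrite ZN0 mN0.
set c := hgker y (a - x) 0 0 Y.
have c0 : 0 < c by rewrite hgker_gt0 ?ltr01// Y0.
have k0 w : 0 < w < 1 -> 0 <= hgker x a 0 0 w.
  by move=> w01; rewrite ltW// hgker_gt0// ltr01.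
rewrite -int01Zl ?(ltW c0)//; last exact: measurable_hgker.
have -> : int01 (fun w => c * hgker x a 0 0 w) =
  (\int[mu]_(u in `]0%R, b[)
    (c * hgker x a 0 0 (F u) * (jac u Y / (1 - Y)))%:E)%E.
  apply: (@ge0_integration_by_substitution_oo R F
    (fun u => jac u Y / (1 - Y)) (fun w => c * hgker x a 0 0 w) 0 b 0 1 b0 F01).
  - move=> w /andP[w0 w1].
    (* [F] is differentiable up to both ends, as 1-mu does not vanish on [[0, b]], and it runs from
       0 to 1. *)
    have [|||u] := @IVT R F 0 b w; first exact: ltW.
    + apply: derivable_within_continuous => u; rewrite in_itv/= => /dF[] //.
    + by rewrite F_0 F_b min_l ?max_r ?ler01// (ltW w0) (ltW w1).
    rewrite in_itv/= => /andP[u0 ub] Fu; exists u => //.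
    rewrite !lt_neqAle u0 ub !andbT; apply/andP; split.
      by apply/eqP => u0'; move: Fu w0; rewrite -u0' F_0 => <-; rewrite ltxx.
    by apply/eqP => u0'; move: Fu w1; rewrite u0' F_b => <-; rewrite ltxx.
  - move=> u ub; have [u01 ub'] : 0 < u < 1 /\ 0 <= u <= b.
      have := ub; rewrite bP => /andP[u01 _].
      by case/andP: ub => /ltW -> /ltW ->.
    have E : jac u Y = 1 - n * Y / (1 - m * u) ^+ 2 by rewrite /jac (inv_D2 u01).
    rewrite E; exact: (dF u ub').
  - move=> u; rewrite in_itv/= bP => /andP[u01 YD].
    have cD : {for u, continuous (fun u : R => 1 - m * u)}.
      apply: continuousB; first exact: cst_continuous.
      by apply: continuousM; [exact: cst_continuous|exact: cvg_id].
    have c1 : {for u, continuous (fun u : R => (1 - m * u) `^ (- 2))}.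
      by apply: continuous_powR_comp; [exact: onem_mul_gt0|exact: cD].
    have c2 : {for u, continuous (fun u : R => 1 - n * Y * (1 - m * u) `^ (- 2))}.
      apply: continuousB; first exact: cst_continuous.
      by apply: (continuousM _ c1); exact: cst_continuous.
    by apply: (continuousM c2); exact: cst_continuous.
  - move=> u; rewrite bP => /andP[u01 YD]; rewrite divr_gt0// jac_gt0//.
    by rewrite Y0.
  - move=> w w01; have c1 : {for w, continuous (hgker x a 0 0)}.
      by apply: continuous_hgker => //; exact: ltr01.
    by apply: (continuousM _ c1); exact: cst_continuous.
  - by move=> w w01; rewrite mulr_ge0 ?(ltW c0) ?k0.
rewrite [RHS]integral_mkcond; apply: eq_integral => u _.
rewrite patchE mem_setE in_itv/= bP /W/= Y0/=; case: ifPn => // /andP[u01 YD].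
have YD' : 0 < Y < 1 - m * u by rewrite Y0.
have := F01 u; rewrite bP u01 => /(_ YD)/andP[F0 F1].
congr EFin; rewrite /psi /c /hgker !powRr0.
have -> : h u Y = (1 - Y) * F u by rewrite Fh// mulrC divfK.
have -> : 1 - Y - (1 - Y) * F u = (1 - Y) * (1 - F u) by ring.
move: (F u) F0 F1 => f F0 F1; have F1' : 0 < 1 - f by rewrite subr_gt0.
rewrite !powRM ?(ltW Z0) ?(ltW F0) ?(ltW F1')//.
(* The extra factor 1-Y comes from dX = (1-Y) dw; it turns the exponent x-1-a into x-a. *)
have -> : (1 - Y) `^ (- (a - x)) = (1 - Y) `^ (x - 1) * (1 - Y) `^ (- a) * (1 - Y).
  rewrite -{4}(powRr1 (ltW Z0)) -!powRD ?(gt_eqF Z0) ?implybT//.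
  by congr (_ `^ _); ring.
by field.
Qed.

(** Tonelli for [W]: integrating in [Y] first gives the left-hand side, in [u] first the right-hand
    side, which is B(y, 1+x-a) B(x, 1-a). *)
Lemma integral_Elliott :
  (\int[mu]_(u in `]0%R, 1%R[) ((hgker x a (y - 1) m u)%:E *
    int01 (fun v => (hgker y a (x - 1) (1 - m) v *
                    (1 - m * u - (1 - m) * v))%R)) =
  int01 (hgker y (a - x) 0 0) * int01 (hgker x a 0 0))%E.
Proof.
transitivity (\int[mu]_u \int[mu]_Y (W (u, Y))%:E)%E.
  rewrite integral_mkcond; apply: eq_integral => u _.
  rewrite patchE mem_setE in_itv/=; case: ifPn => [u01|u01].
    by rewrite integral_W_Y.
  by rewrite integral0_eq// => Y _; rewrite /W/= (negbTE u01).
rewrite (@fubini_tonelli _ _ _ _ _ mu mu (EFin \o W))/=; last 2 first.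
- exact/measurable_EFinP.
- by move=> z; rewrite lee_fin.
transitivity (\int[mu]_(Y in `]0%R, 1%R[)
    (int01 (hgker x a 0 0) * (hgker y (a - x) 0 0 Y)%:E))%E.
  rewrite [RHS]integral_mkcond; apply: eq_integral => Y _.
  rewrite patchE mem_setE in_itv/=; case: ifPn => [Y01|Y01].
    by rewrite integral_W_u// muleC.
  (* For Y >= 1 the slice is empty because Y < 1-mu < 1 on the support. *)
  rewrite integral0_eq// => u _; rewrite /W/=; case: ifPn => // /andP[/andP[u0 u1]].
  move=> /andP[Y0 YD]; move: Y01; rewrite Y0/= -leNgt => Y1.
  have := le_lt_trans Y1 YD; rewrite ltrBrDr gtrDl ltNge.
  by rewrite mulr_ge0// ltW.
rewrite ge0_integralZl; first by rewrite muleC.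
- exact: measurable_itv.
- by apply/measurable_EFinP; apply: measurable_funS (measurable_hgker _ _ _ _).
- by move=> Y; rewrite /= in_itv/= lee_fin => Y01; rewrite ltW// hgker_gt0// ltr01.
- by apply: int01_ge0 => u u01; rewrite ltW// hgker_gt0// ltr01.
Qed.

End Elliott.

(** Infinite [z] is included: both sides are then 0 since [fine] sends both infinities to 0. *)
Lemma fineZl (R : realType) (c : R) (z : \bar R) : 0 < c ->
  fine (c%:E * z)%E = c * fine z.
Proof.
move=> c0; case: z => [z| |] //=; first by rewrite gt0_muley ?lte_fin// mulr0.
by rewrite gt0_muleNy ?lte_fin// mulr0.
Qed.

(** The integral of g-f is positive, and adding it to a finite quantity gives a strict increase. *)
Lemma lt_int01 (R : realType) (f g : R -> R) :
  measurable_fun setT f -> measurable_fun setT g ->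
  (forall u, 0 < u < 1 -> 0 <= f u < g u) ->
  int01 f \is a fin_num -> (int01 f < int01 g)%E.
Proof.
move=> mf mg fg fin.
have -> : int01 g = (int01 f + int01 (fun u => (g u - f u)%R))%E.
  rewrite -int01D; first by apply: eq_int01 => u _; rewrite addrC subrK.
  - exact: mf.
  - exact: measurable_funB.
  - by move=> u /fg/andP[].
  - by move=> u /fg/andP[_ /ltW]; rewrite subr_ge0.
rewrite lteDl//; apply: int01_gt0; first exact: measurable_funB.
by move=> u /fg/andP[_]; rewrite subr_gt0.
Qed.

(** * Elliott's identity for Euler integrals *)

Section Elliott_identity.
Variables (R : realType) (x y a m : R).
Hypotheses (x0 : 0 < x) (y0 : 0 < y) (a1 : a < 1) (m01 : 0 < m < 1).

(** Splitting 1-mu-nv = (1-nv) - mu makes the inner integral of the double integral E' - muK'; then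
    mu = 1 - (1-mu) makes the outer one E'K - K'(K - E). *)
Lemma Elliott_identity :
  fine (int01 (hgker x a y m)) * fine (int01 (hgker y a (x - 1) (1 - m)))
  + fine (int01 (hgker x a (y - 1) m)) * fine (int01 (hgker y a x (1 - m)))
  - fine (int01 (hgker x a (y - 1) m)) *
    fine (int01 (hgker y a (x - 1) (1 - m))) =
  fine (int01 (hgker y (a - x) 0 0)) * fine (int01 (hgker x a 0 0)).
Proof.
have /andP[m0 m1] := m01; set n := 1 - m.
have n0 : 0 < n by rewrite subr_gt0.
have n1 : n < 1 by rewrite ltrBlDr ltrDl.
have finE s e c : 0 < s -> 0 <= c < 1 ->
    exists I, int01 (hgker s a e c) = (I : R)%:E.
  by move=> s0 c01; eexists; apply/esym/fineK/int01_hgker_fin.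
have mc : 0 <= m < 1 by rewrite m1 ltW.
have nc : 0 <= n < 1 by rewrite n1 ltW.
have oc : 0 <= (0 : R) < 1 by rewrite lexx ltr01.
have [K KE] := finE x (y - 1) m x0 mc.
have [E EE] := finE x y m x0 mc.
have [K' K'E] := finE y (x - 1) n y0 nc.
have [E' E'E] := finE y x n y0 nc.
have [B BE] := finE x 0 0 x0 oc.
have [B' B'E] : exists B', int01 (hgker y (a - x) 0 0) = (B' : R)%:E.
  eexists; apply/esym/fineK/int01_hgker_fin => //.
  by rewrite ltrBlDr (lt_trans a1)// ltrDl.
rewrite KE EE K'E E'E BE B'E /=.
have ker0 s t e c (u : R) : c < 1 -> 0 < u < 1 -> 0 <= hgker s t e c u.
  by move=> c1 u01; rewrite ltW// hgker_gt0.
have K0 : 0 <= K by rewrite -lee_fin -KE int01_ge0// => u; exact: ker0.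
have K'0 : 0 <= K' by rewrite -lee_fin -K'E int01_ge0// => u; exact: ker0.
have E'0 : 0 <= E' by rewrite -lee_fin -E'E int01_ge0// => u; exact: ker0.
(* Lowering the last exponent by 1 relates the integrands of E and K. *)
have kerS s b e c (u : R) : c < 1 -> 0 < u < 1 ->
    hgker s b e c u = hgker s b (e - 1) c u * (1 - c * u).
  move=> c1 u01; have D0 := onem_mul_gt0 c1 u01; rewrite /hgker.
  have -> : (1 - c * u) `^ e = (1 - c * u) `^ (e - 1) * (1 - c * u) `^ 1.
    by rewrite -powRD ?subrK// (gt_eqF D0) implybT.
  by rewrite (powRr1 (ltW D0)) mulrA.
have jac0 u v : 0 < u < 1 -> 0 < v < 1 -> 0 <= 1 - m * u - n * v.
  move=> u01 v01; have /andP[u0 u1] := u01; have /andP[v0 v1] := v01.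
  have -> : 1 - m * u - (1 - m) * v = m * (1 - u) + n * (1 - v) by rewrite /n; ring.
  by rewrite addr_ge0// mulr_ge0 ?subr_ge0// ltW.
have mjac u : measurable_fun setT
    (fun v => hgker y a (x - 1) n v * (1 - m * u - n * v)).
  apply: measurable_funM; first exact: measurable_hgker.
  apply: measurable_funB; first exact: measurable_cst.
  by apply: measurable_funM; [exact: measurable_cst|exact: measurable_id].
have innerE u : 0 < u < 1 ->
    int01 (fun v => hgker y a (x - 1) n v * (1 - m * u - n * v)) =
    (E' - m * u * K')%:E.
  move=> u01; have mu0 : 0 <= m * u by rewrite mulr_ge0 ?ltW//; case/andP: u01.
  (* Subtraction is avoided under the integral sign: additivity is available for nonnegative
     integrands only. *)
  set X := int01 _; suff H : (E'%:E = X + (m * u * K')%:E)%E.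
    by rewrite EFinB H addeK.
  rewrite EFinM -K'E -E'E -int01Zl; first last.
  - exact: mu0.
  - by move=> v; exact: ker0.
  - exact: measurable_hgker.
  rewrite /X -int01D.
  - by apply: eq_int01 => v v01; rewrite kerS//; ring.
  - exact: mjac.
  - by apply: measurable_funM; [exact: measurable_cst|exact: measurable_hgker].
  - by move=> v v01; rewrite mulr_ge0 ?ker0// jac0.
  - by move=> v v01; rewrite mulr_ge0 ?ker0.
have inner0 u : 0 < u < 1 -> 0 <= E' - m * u * K'.
  move=> u01; rewrite -lee_fin -innerE//; apply: int01_ge0 => v v01.
  by rewrite mulr_ge0 ?ker0 ?jac0.
have minner : measurable_fun setT
    (fun u => hgker x a (y - 1) m u * (E' - m * u * K')).
  apply: measurable_funM; first exact: measurable_hgker.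
  apply: measurable_funB; first exact: measurable_cst.
  apply: measurable_funM; last exact: measurable_cst.
  by apply: measurable_funM; [exact: measurable_cst|exact: measurable_id].
have IE : int01 (fun u => hgker x a (y - 1) m u * (E' - m * u * K')) =
    (int01 (hgker y (a - x) 0 0) * int01 (hgker x a 0 0))%E.
  rewrite -(integral_Elliott x y a m01); apply: eq_integral => u.
  by rewrite inE/= in_itv/= => u01; rewrite innerE.
have mZ c s b e d : measurable_fun setT (fun u : R => c * hgker s b e d u).
  by apply: measurable_funM; [exact: measurable_cst|exact: measurable_hgker].
have scaleE c s b e d : 0 <= c -> d < 1 ->
    (c%:E * int01 (hgker s b e d))%E = int01 (fun u : R => c * hgker s b e d u).
  move=> c0 d1; apply/esym/int01Zl => //; first exact: measurable_hgker.
  by move=> u; exact: ker0.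
have pos c s b e d (u : R) : 0 <= c -> d < 1 -> 0 < u < 1 -> 0 <= c * hgker s b e d u.
  by move=> c0 d1 u01; rewrite mulr_ge0 ?ker0.
(* The identity with K'K moved to the right, so that every integrand is nonnegative. *)
have sumE : (E'%:E * K%:E + K'%:E * E%:E =
    int01 (hgker y (a - x) 0 0) * int01 (hgker x a 0 0) + K'%:E * K%:E)%E.
  have T1 := scaleE E' x a (y - 1) m E'0 m1; rewrite KE in T1.
  have T2 := scaleE K' x a y m K'0 m1; rewrite EE in T2.
  have T3 := scaleE K' x a (y - 1) m K'0 m1; rewrite KE in T3.
  rewrite T1 T2 T3 -IE.
  rewrite -(int01D (mZ _ _ _ _ _) (mZ _ _ _ _ _)); first last.
  - by move=> u; exact: pos.
  - by move=> u; exact: pos.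
  rewrite -(int01D minner (mZ _ _ _ _ _)); first last.
  - by move=> u; exact: pos.
  - by move=> u u01; rewrite mulr_ge0 ?ker0 ?inner0.
  by apply: eq_int01 => u u01; rewrite (kerS x a y m)//; ring.
move: sumE; rewrite BE B'E -!EFinM -!EFinD => -[H].
have -> : E * K' + K * E' = E' * K + K' * E by ring.
by rewrite H; ring.
Qed.

End Elliott_identity.

(* The integral L(x, y, m), with exponent - alpha = a - x - y. *)
Definition hgdual (R : realType) (x y a m : R) : \bar R :=
  int01 (fun w => w `^ (x - 1) * (1 - w) `^ (- a) *
                  (1 - m + m * w) `^ (a - x - y)).

(** * Positivity, finiteness and monotonicity of L in the modulus *)

Section hgdual_theory.
Variable R : realType.
Implicit Types x y a m w : R.

Lemma hgdual_base_gt0 m w : 0 < m < 1 -> 0 < w < 1 -> 0 < 1 - m + m * w.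
Proof.
move=> /andP[m0 m1] /andP[w0 w1].
by rewrite addr_gt0 ?subr_gt0// mulr_gt0.
Qed.

Lemma measurable_hgdual x y a m : measurable_fun setT (fun w : R =>
  w `^ (x - 1) * (1 - w) `^ (- a) * (1 - m + m * w) `^ (a - x - y)).
Proof.
by repeat (apply: measurable_funM || apply: measurable_funB ||
  apply: measurable_funD || apply: measurable_powR_comp ||
  apply: measurable_id || apply: measurable_cst).
Qed.

Lemma fine_Euler x y a m : 0 < m < 1 ->
  fine (int01 (hgker x a (y - 1) m)) =
  (1 - m) `^ (y - a) * fine (hgdual x y a m).
Proof.
move=> /andP[m0 m1].
by rewrite int01_Euler ?m1 ?ltW// fineZl// powR_gt0// subr_gt0.
Qed.

Lemma hgdual_gt0 x y a m : 0 < m < 1 -> (0 < hgdual x y a m)%E.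
Proof.
move=> m01; apply: int01_gt0 => [|w w01]; first exact: measurable_hgdual.
have := hgdual_base_gt0 m01 w01; case/andP: w01 => w0 w1 D0.
by rewrite !mulr_gt0// powR_gt0// subr_gt0.
Qed.

(** Finiteness is inherited from the Euler integral, which is a positive multiple of L. *)
Lemma hgdual_fin x y a m : 0 < x -> a < 1 -> 0 < m < 1 ->
  hgdual x y a m \is a fin_num.
Proof.
move=> x0 a1 /andP[m0 m1]; have mc : 0 <= m < 1 by rewrite m1 ltW.
have := int01_hgker_fin (y - 1) x0 a1 mc; rewrite int01_Euler//.
have P0 : 0 < (1 - m) `^ (y - a) by rewrite powR_gt0// subr_gt0.
rewrite -/(hgdual x y a m); case: (hgdual x y a m) => [//| |].
  by rewrite gt0_muley ?lte_fin.
by rewrite gt0_muleNy ?lte_fin.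
Qed.

Lemma fine_hgdual_gt0 x y a m : 0 < x -> a < 1 -> 0 < m < 1 ->
  0 < fine (hgdual x y a m).
Proof.
by move=> x0 a1 m01; rewrite fine_gt0// hgdual_gt0// ltey_eq hgdual_fin.
Qed.

(** The base 1-m+mw = 1-m(1-w) decreases in m, and its exponent is negative. *)
Lemma hgdual_incr x y a m1 m2 : 0 < x -> a < 1 -> a - x - y < 0 ->
  0 < m1 -> m1 < m2 -> m2 < 1 ->
  fine (hgdual x y a m1) < fine (hgdual x y a m2).
Proof.
move=> x0 a1 e0 m10 m12 m21.
have m101 : 0 < m1 < 1 by rewrite m10 (lt_trans m12).
have m201 : 0 < m2 < 1 by rewrite m21 (lt_trans m10).
apply: fine_lt; [exact: hgdual_fin|exact: hgdual_fin|].
apply: lt_int01; last exact: hgdual_fin.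
- exact: measurable_hgdual.
- exact: measurable_hgdual.
move=> w w01; rewrite !mulr_ge0 ?powR_ge0//=.
have D2 := hgdual_base_gt0 m201 w01; case/andP: w01 => w0 w1.
rewrite ltr_pM2l ?mulr_gt0 ?powR_gt0 ?subr_gt0//.
apply: lt0_gtr_powR => //; rewrite D2/= -subr_gt0.
have -> : 1 - m1 + m1 * w - (1 - m2 + m2 * w) = (m2 - m1) * (1 - w) by ring.
by rewrite mulr_gt0 ?subr_gt0.
Qed.

Lemma hgdual_decr x y a m1 m2 : 0 < x -> a < 1 -> 0 < a - x - y ->
  0 < m1 -> m1 < m2 -> m2 < 1 ->
  fine (hgdual x y a m2) < fine (hgdual x y a m1).
Proof.
move=> x0 a1 e0 m10 m12 m21.
have m101 : 0 < m1 < 1 by rewrite m10 (lt_trans m12).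
have m201 : 0 < m2 < 1 by rewrite m21 (lt_trans m10).
apply: fine_lt; [exact: hgdual_fin|exact: hgdual_fin|].
apply: lt_int01; last exact: hgdual_fin.
- exact: measurable_hgdual.
- exact: measurable_hgdual.
move=> w w01; rewrite !mulr_ge0 ?powR_ge0//=.
have D1 := hgdual_base_gt0 m101 w01; have D2 := hgdual_base_gt0 m201 w01.
case/andP: w01 => w0 w1; rewrite ltr_pM2l ?mulr_gt0 ?powR_gt0 ?subr_gt0//.
rewrite gt0_ltr_powR// ?nnegrE ?(ltW D1) ?(ltW D2)// -subr_gt0.
have -> : 1 - m1 + m1 * w - (1 - m2 + m2 * w) = (m2 - m1) * (1 - w) by ring.
by rewrite mulr_gt0 ?subr_gt0.
Qed.

End hgdual_theory.

(** * Elliptic integrals *)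

Section elliptic_integrals.
Variable R : realType.
Implicit Types p q r k a c d e m s t : R.

Lemma Rintegral_powR_subst a e m q : m < 1 -> 0 < q ->
  \int[@lebesgue_measure R]_(t in `[0, 1])
    ((1 - t `^ q) `^ (- a) * (1 - m * t `^ q) `^ e) =
  q^-1 * fine (int01 (hgker q^-1 a e m)).
Proof.
move=> m1 q0; rewrite Rintegral01E.
  by rewrite int01_powR_subst// fineZl// mulKf// gt_eqF.
by repeat (apply: measurable_funM || apply: measurable_funB ||
  apply: measurable_powR_comp || apply: measurable_id || apply: measurable_cst).
Qed.

Lemma ellKE p q r k : 0 < q -> 0 < k < 1 ->
  ellK p q r k = q^-1 * fine (int01 (hgker q^-1 p^-1 (r^-1 - 1) (k `^ q))).
Proof.
move=> q0 k01; have /andP[_ m1] := powR_itv01 q0 k01.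
rewrite -Rintegral_powR_subst//; apply: eq_Rintegral => t _.
by rewrite invfM -!powRN opprB.
Qed.

Lemma ellEE p q r k : 0 < q -> 0 < k < 1 ->
  ellE p q r k = q^-1 * fine (int01 (hgker q^-1 p^-1 r^-1 (k `^ q))).
Proof.
move=> q0 k01; have /andP[_ m1] := powR_itv01 q0 k01.
rewrite -Rintegral_powR_subst//; apply: eq_Rintegral => t _.
by rewrite -powRN mulrC.
Qed.

Lemma gen_piE p q : 0 < q ->
  gen_pi p q = 2 * (q^-1 * fine (int01 (hgker q^-1 p^-1 0 0))).
Proof.
move=> q0; rewrite -Rintegral_powR_subst ?ltr01//; congr (_ * _).
by apply: eq_Rintegral => t _; rewrite powRr0 mulr1.
Qed.

(** The reflection puts d first, matching the factor [hgker y (a - x) 0 0] of Elliott's identity. *)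
Lemma BetaE c d : Beta c d = fine (int01 (hgker d (1 - c) 0 0)).
Proof.
rewrite /Beta Rintegral01E.
  rewrite [in RHS]int01_onem.
  - congr (fine _); apply: eq_int01 => t _.
    by rewrite /hgker powRr0 mulr1 subKr opprB mulrC.
  - by apply: continuous_hgker; exact: ltr01.
  - by move=> t t01; rewrite ltW// hgker_gt0// ltr01.
by repeat (apply: measurable_funM || apply: measurable_funB ||
  apply: measurable_powR_comp || apply: measurable_id || apply: measurable_cst).
Qed.

Lemma comodulus_itv01 q r k : 0 < q -> 0 < r -> 0 < k < 1 ->
  0 < comodulus q r k < 1.
Proof.
move=> q0 r0 k01; apply: powR_itv01; first by rewrite invr_gt0.
by have /andP[m0 m1] := powR_itv01 q0 k01; rewrite subr_gt0 m1 ltrBlDr ltrDl.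
Qed.

Lemma comodulus_powR q r k s : 0 < r ->
  comodulus q r k `^ s = (1 - k `^ q) `^ (s / r).
Proof. by move=> r0; rewrite -powRrM mulrC. Qed.

Lemma comodulus_powRr q r k : 0 < q -> 0 < r -> 0 < k < 1 ->
  comodulus q r k `^ r = 1 - k `^ q.
Proof.
move=> q0 r0 k01; have /andP[m0 m1] := powR_itv01 q0 k01.
have n0 : 0 <= 1 - k `^ q by rewrite subr_ge0 ltW.
by rewrite (comodulus_powR _ _ _ r0) (divff (lt0r_neq0 r0)) (powRr1 n0).
Qed.

Lemma ellK'E p q r k : 0 < q -> 0 < r -> 0 < k < 1 ->
  ellK' p r q k =
  r^-1 * fine (int01 (hgker r^-1 p^-1 (q^-1 - 1) (1 - k `^ q))).
Proof.
move=> q0 r0 k01.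
by rewrite /ellK' (ellKE _ _ r0 (comodulus_itv01 q0 r0 k01)) comodulus_powRr.
Qed.

Lemma ellE'E p q r k : 0 < q -> 0 < r -> 0 < k < 1 ->
  ellE' p r q k = r^-1 * fine (int01 (hgker r^-1 p^-1 q^-1 (1 - k `^ q))).
Proof.
move=> q0 r0 k01.
by rewrite /ellE' (ellEE _ _ r0 (comodulus_itv01 q0 r0 k01)) comodulus_powRr.
Qed.

Lemma fine_int01_hgker_gt0 (x a e m : R) : 0 < x -> a < 1 -> 0 <= m < 1 ->
  0 < fine (int01 (hgker x a e m)).
Proof.
move=> x0 a1 m01; rewrite fine_gt0// int01_hgker_lty// andbT.
apply: int01_gt0 => [|u]; first exact: measurable_hgker.
by apply: hgker_gt0; case/andP: m01.
Qed.

Lemma legendre_relation p q r k : 1 < p -> 1 < q -> 1 < r -> 0 < k < 1 ->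
  ellE p q r k * ellK' p r q k + ellK p q r k * ellE' p r q k
    - ellK p q r k * ellK' p r q k
  = gen_pi p q / (2 * r) * Beta ((dual_exponent p)^-1 + q^-1) r^-1.
Proof.
move=> hp hq hr k01.
have p0 := lt_trans ltr01 hp; have q0 := lt_trans ltr01 hq.
have r0 := lt_trans ltr01 hr.
have a1 : p^-1 < 1 by rewrite invf_lt1.
have x0 : 0 < q^-1 by rewrite invr_gt0.
have y0 : 0 < r^-1 by rewrite invr_gt0.
have m01 := powR_itv01 q0 k01.
rewrite ellEE// ellKE// ellK'E// ellE'E// gen_piE// BetaE.
have -> : 1 - ((dual_exponent p)^-1 + q^-1) = p^-1 - q^-1.
  rewrite /dual_exponent; field.
  by rewrite !gt_eqF// subr_gt0.
have scale (E K E' K' B B' : R) : E * K' + K * E' - K * K' = B * B' ->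
    q^-1 * E * (r^-1 * K') + q^-1 * K * (r^-1 * E') - q^-1 * K * (r^-1 * K')
    = 2 * (q^-1 * B') / (2 * r) * B.
  move=> H; transitivity (q^-1 * r^-1 * (E * K' + K * E' - K * K')).
    by ring.
  by rewrite H; field; rewrite !gt_eqF.
exact: scale (Elliott_identity x0 y0 a1 m01).
Qed.

Lemma ellK_hgdual p q r k : 0 < q -> 0 < k < 1 ->
  ellK p q r k = (1 - k `^ q) `^ (r^-1 - p^-1) *
    (q^-1 * fine (hgdual q^-1 r^-1 p^-1 (k `^ q))).
Proof.
move=> q0 k01.
by rewrite (ellKE _ _ q0 k01) (fine_Euler _ _ _ (powR_itv01 q0 k01)) mulrCA.
Qed.

Lemma ellK'_hgdual p q r k : 0 < q -> 0 < r -> 0 < k < 1 ->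
  k `^ (q / p - 1) * comodulus q r k `^ (1 - r / p) * ellK' p r q k =
  (1 - k `^ q) `^ (r^-1 - p^-1) *
    (r^-1 * fine (hgdual r^-1 q^-1 p^-1 (1 - k `^ q))).
Proof.
move=> q0 r0 k01; have m01 := powR_itv01 q0 k01; have /andP[m0 m1] := m01.
have n01 : 0 < 1 - k `^ q < 1 by rewrite subr_gt0 m1 ltrBlDr ltrDl.
rewrite (ellK'E _ q0 r0 k01) (fine_Euler _ _ _ n01) (comodulus_powR _ _ _ r0).
have -> : (1 - r / p) / r = r^-1 - p^-1.
  by rewrite mulrBl mul1r mulrAC mulfV ?mul1r// gt_eqF.
rewrite subKr -powRrM.
have E : k `^ (q / p - 1) * k `^ (q * (q^-1 - p^-1)) = 1.
  have /andP[k0 _] := k01; rewrite -powRD; last by rewrite (gt_eqF k0) implybT.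
  have -> : q / p - 1 + q * (q^-1 - p^-1) = 0.
    by rewrite mulrBr mulfV ?gt_eqF//; ring.
  exact: powRr0.
have scale (S T P L : R) : S * T = 1 -> S * P * (r^-1 * (T * L)) = P * (r^-1 * L).
  by move=> ST; rewrite -[RHS]mulr1 -ST; ring.
exact: scale E.
Qed.

Lemma hgdual_alpha0 (x y a m : R) : a - x - y = 0 ->
  hgdual x y a m = int01 (hgker x a 0 0).
Proof.
by move=> e0; apply: eq_int01 => u _; rewrite /hgker e0 !powRr0.
Qed.

Lemma linearly_dependent_hgdual p q r : 1 < p -> 1 < q -> 1 < r ->
  linearly_dependent_on `]0, 1[ (fun k => ellK p q r k)
    (fun k => k `^ (q / p - 1) * comodulus q r k `^ (1 - r / p)
              * ellK' p r q k) ->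
  exists c d : R, (c, d) <> (0, 0) /\ forall m, 0 < m < 1 ->
    c * fine (hgdual q^-1 r^-1 p^-1 m) +
    d * fine (hgdual r^-1 q^-1 p^-1 (1 - m)) = 0.
Proof.
move=> hp hq hr [c [d [cd0 cdE]]].
have q0 := lt_trans ltr01 hq; have r0 := lt_trans ltr01 hr.
exists (c * q^-1), (d * r^-1); split.
  move=> [/eqP + /eqP]; rewrite !mulf_eq0 !invr_eq0 !(gt_eqF q0) !(gt_eqF r0) !orbF.
  by move=> /eqP c0 /eqP d0; apply: cd0; rewrite c0 d0.
move=> m m01; have qV0 : 0 < q^-1 by rewrite invr_gt0.
have k01 := powR_itv01 qV0 m01; have mk : (m `^ q^-1) `^ q = m.
  by rewrite -powRrM mulVf ?gt_eqF// powRr1// ltW//; case/andP: m01.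
have := cdE (m `^ q^-1); rewrite /= in_itv/= k01 => /(_ isT).
rewrite ellK'_hgdual// ellK_hgdual// mk.
have P0 : 0 < (1 - m) `^ (r^-1 - p^-1).
  by rewrite powR_gt0// subr_gt0; case/andP: m01.
have cancel (P A B : R) : 0 < P ->
    c * (P * (q^-1 * A)) + d * (P * (r^-1 * B)) = 0 ->
    c * q^-1 * A + d * r^-1 * B = 0.
  move=> P_gt0 H; apply: (mulfI (lt0r_neq0 P_gt0)); rewrite mulr0 -[RHS]H.
  by ring.
exact: cancel P0.
Qed.

Lemma eq0_of_opposite_monotony (c d A1 A2 B1 B2 : R) :
  0 < A1 -> 0 < A2 -> 0 < B1 -> 0 < B2 ->
  (A1 < A2 /\ B1 < B2) \/ (A2 < A1 /\ B2 < B1) ->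
  c * A1 + d * B2 = 0 -> c * A2 + d * B1 = 0 -> (c, d) = (0, 0).
Proof.
move=> A1_gt0 A2_gt0 B1_gt0 B2_gt0 mono E1 E2.
have det : A1 * B1 - A2 * B2 != 0.
  rewrite subr_eq0; case: mono => -[ltA ltB].
    by rewrite lt_eqF// ltr_pM// ltW.
  by rewrite gt_eqF// ltr_pM// ltW.
congr pair; apply: (mulIf det); rewrite mul0r.
  transitivity (B1 * (c * A1 + d * B2) - B2 * (c * A2 + d * B1)); first by ring.
  by rewrite E1 E2; ring.
transitivity (A1 * (c * A2 + d * B1) - A2 * (c * A1 + d * B2)); first by ring.
by rewrite E1 E2; ring.
Qed.

Lemma linear_dependence_iff p q r : 1 < p -> 1 < q -> 1 < r ->
  linearly_dependent_on `]0, 1[ (fun k => ellK p q r k)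
    (fun k => k `^ (q / p - 1) * comodulus q r k `^ (1 - r / p)
              * ellK' p r q k)
  <-> q^-1 + r^-1 - p^-1 = 0.
Proof.
move=> hp hq hr.
have p0 := lt_trans ltr01 hp; have q0 := lt_trans ltr01 hq.
have r0 := lt_trans ltr01 hr.
have a1 : p^-1 < 1 by rewrite invf_lt1.
have x0 : 0 < q^-1 by rewrite invr_gt0.
have y0 : 0 < r^-1 by rewrite invr_gt0.
split=> [/(linearly_dependent_hgdual hp hq hr)|alpha0].
  move=> [c [d [cd0 cdE]]]; apply/eqP; apply: contrapT => /negP alpha0.
  have m1 : 0 < (3^-1 : R) < 1 by lra.
  have m2 : 0 < (1 - 3^-1 : R) < 1 by lra.
  have m12 : (3^-1 : R) < 1 - 3^-1 by lra.
  have E1 := cdE _ m1; have E2 := cdE _ m2; rewrite subKr in E2.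
  have /andP[m10 _] := m1; have /andP[_ m21] := m2.
  apply: cd0; apply: (eq0_of_opposite_monotony _ _ _ _ _ E1 E2);
    [exact: fine_hgdual_gt0|exact: fine_hgdual_gt0|exact: fine_hgdual_gt0|
     exact: fine_hgdual_gt0|].
  have [e0|e0|e0] := ltgtP (p^-1 - q^-1 - r^-1) 0.
  - have e0' := e0; rewrite addrAC in e0'.
    by left; split; [exact: hgdual_incr|exact: hgdual_incr].
  - have e0' := e0; rewrite addrAC in e0'.
    by right; split; [exact: hgdual_decr|exact: hgdual_decr].
  - by exfalso; apply: (negP alpha0); rewrite -oppr_eq0 -e0; apply/eqP; ring.
have xy0 : p^-1 - q^-1 - r^-1 = 0 by lra.
have yx0 : p^-1 - r^-1 - q^-1 = 0 by lra.
have oc : 0 <= (0 : R) < 1 by rewrite lexx ltr01.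
pose C := q^-1 * fine (int01 (hgker q^-1 p^-1 0 0)).
pose C' := r^-1 * fine (int01 (hgker r^-1 p^-1 0 0)).
exists C', (- C); split.
  have C'0 : 0 < C' by rewrite mulr_gt0 ?fine_int01_hgker_gt0.
  by move=> [C'E _]; rewrite C'E ltxx in C'0.
move=> k; rewrite /= in_itv/= => k01.
rewrite ellK'_hgdual// ellK_hgdual// !hgdual_alpha0//.
by rewrite -/C -/C'; ring.
Qed.

End elliptic_integrals.

Unset Implicit Arguments.
Set Strict Implicit.

Theorem theorem5p5 (R : realType) (p q r : R)
    (hp : 1 < p) (hq : 1 < q) (hr : 1 < r) :
  (forall k : R, 0 < k < 1 ->
     ellE p q r k * ellK' p r q k + ellK p q r k * ellE' p r q k
       - ellK p q r k * ellK' p r q k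
     = gen_pi p q / (2 * r) * Beta ((dual_exponent p)^-1 + q^-1) r^-1)
  /\ (exists c : R, c <> 0 /\ forall k : R, 0 < k < 1 ->
     ellE p q r k * ellK' p r q k + ellK p q r k * ellE' p r q k
       - ellK p q r k * ellK' p r q k = c)
  /\ (linearly_dependent_on `]0, 1[
        (fun k => ellK p q r k)
        (fun k => k `^ (q / p - 1) * comodulus q r k `^ (1 - r / p)
                  * ellK' p r q k)
      <-> q^-1 + r^-1 - p^-1 = 0).
Proof.
have p0 := lt_trans ltr01 hp; have q0 := lt_trans ltr01 hq.
have r0 := lt_trans ltr01 hr.
have a1 : p^-1 < 1 by rewrite invf_lt1.
have oc : 0 <= (0 : R) < 1 by rewrite lexx ltr01.
split; first by move=> k; exact: legendre_relation.
split; last exact: linear_dependence_iff.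
exists (gen_pi p q / (2 * r) * Beta ((dual_exponent p)^-1 + q^-1) r^-1).
split; last by move=> k; exact: legendre_relation.
apply/eqP; rewrite gt_eqF// gen_piE// BetaE mulr_gt0//.
  rewrite divr_gt0 ?mulr_gt0 ?invr_gt0//.
  by rewrite fine_int01_hgker_gt0 ?invr_gt0.
rewrite fine_int01_hgker_gt0 ?invr_gt0// ltrBlDr ltrDl.
have p1 : 0 < p - 1 by rewrite subr_gt0.
by rewrite addr_gt0 ?invr_gt0// divr_gt0.
Qed.
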